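(* Every circle-center set $S\subset\mathbb{R}^2$ is dense in $\mathbb{R}^2$.
   Context: A set $S\subset\mathbb{R}^2$ is said to contain its circle centers if, for any three non-collinear points of $S$, the center of the circle through those three points (their circumcenter) is also in $S$. A circle-center set is a subset of $\mathbb{R}^2$ that is not a subset of any line and that contains its circle centers. *)

(* Defs.v *)
From HB Require Import structures.
From mathcomp Require Import all_boot all_order all_algebra.
From mathcomp Require Import all_classical all_reals all_analysis.
Import Order.TTheory GRing.Theory Num.Theory.
Import numFieldNormedType.Exports.

Set Implicit Arguments.
Unset Strict Implicit.
Unset Printing Implicit Defensive.

Local Open Scope classical_set_scope.
Local Open Scope ring_scope.

Section CircleCenter.
Variable R : realType.

(* The library's norm on R * R is the max norm, so the Euclidean distance is
   spelled out; both induce the product topology. *)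
Definition edist (p q : R * R) : R :=
  Num.sqrt ((p.1 - q.1) ^+ 2 + (p.2 - q.2) ^+ 2).

Definition is_line (L : set (R * R)) : Prop :=
  exists p v : R * R, v != (0, 0) /\
    L = [set x | exists t : R, x = (p.1 + t * v.1, p.2 + t * v.2)].

Definition collinear (p q r : R * R) : Prop :=
  exists L : set (R * R), [/\ is_line L, L p, L q & L r].

Definition circle (c : R * R) (rho : R) : set (R * R) :=
  [set x | edist x c = rho].

Definition is_circumcenter (c p q r : R * R) : Prop :=
  exists rho : R, [/\ 0 < rho, circle c rho p, circle c rho q & circle c rho r].

(* Three non-collinear points have exactly one circumcenter, so quantifying
   over all c satisfying is_circumcenter speaks about "the" circumcenter. *)
Definition contains_circle_centers (S : set (R * R)) : Prop :=
  forall p q r c : R * R, S p -> S q -> S r ->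
    ~ collinear p q r -> is_circumcenter c p q r -> S c.

Definition circle_center_set (S : set (R * R)) : Prop :=
  (forall L : set (R * R), is_line L -> ~ S `<=` L) /\
  contains_circle_centers S.

End CircleCenter.

(* Main.v *)
Require Import Defs.
From HB Require Import structures.
From mathcomp Require Import all_boot all_order all_algebra.
From mathcomp Require Import ring lra zify.
From mathcomp Require Import all_classical all_reals all_analysis.
Import Order.TTheory GRing.Theory Num.Theory.
Import numFieldNormedType.Exports.
Local Open Scope classical_set_scope.
Local Open Scope ring_scope.

(** Circumcenters depend continuously on a nondegenerate triangle, so the
closure [T] of a circle-center set is again closed under circumcenters
([closure_center_closed]); it remains to show that [T] is the whole plane.
Similarities preserve circumcenters, hence coordinates can be changed freely
([center_closed_frame]); identifying the plane with the complex numbers, these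
changes are the maps z |-> p + z v with v nonzero ([frame]).

A nondegenerate triangle together with its circumcenter contains an isosceles
triangle. Normalize its base to be the segment from -1 to 1 and its apex to be
k i. Replacing the apex by the circumcenter doubles the apex angle
([isosceles_doubling]), so after finitely many steps the angle is between 30
and 150 degrees, that is k ^ 2 + 1 < 4 k. For such an angle, taking two
circumcenters produces a similar triangle, turned by a right angle and
shrunk by the factor r = (k ^ 2 + 1) / (4 k) < 1 ([isosceles_rotation]).
Iterating gives a sequence of points in [T] that spirals into the fixed point
of that similarity: in coordinates centered there, [T] contains the points
(i r) ^ n.

Now [T] contains 0 and clusters there along both coordinate axes. If [T]
clusters at 0 along a direction d, the circles through 0, another point z
of [T] and t d tend, as t tends to 0, to the circle through z tangent to d
at 0; so [T] contains the center of that circle ([tangent_center]). Tangent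
circles to the axes halve points of the axes, which makes [T] cluster along
all the directions (1 / 2 ^ m, r / 2 ^ n); circles tangent to such a direction
d allow to multiply the points of the first axis by
(1 + (d.1 / d.2) ^ 2) / 4. These factors take values larger than 1 and values
above but arbitrarily close to 1 / 4, which is itself available. Together
they make the multiples of a point dense ([multiplicative_density]), and [T]
contains the whole positive half-axis. Hence [T] clusters along every
direction of the first quadrant, and the corresponding tangent circles have
centers filling the fourth quadrant. Finally a large circle around any point
of the plane meets that quadrant three times ([fourth_quadrant_full]). *)

Section CircleCenterSets.
Set Implicit Arguments.
Unset Strict Implicit.
Context {R : realType}.
Implicit Types (a b c o p v z d : R * R) (S T : set (R * R)).

(** * Circumcenters in coordinates *)

Definition sqd p q : R := (p.1 - q.1) ^+ 2 + (p.2 - q.2) ^+ 2.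

(** Twice the signed area of the triangle: zero exactly on collinear triples. *)
Definition cross a b c : R :=
  (b.1 - a.1) * (c.2 - a.2) - (b.2 - a.2) * (c.1 - a.1).

(** The circumcenter [o] is characterized by squared distances, which keeps
every use of closure under circumcenters polynomial. *)
Definition center_closed T : Prop :=
  forall a b c o, T a -> T b -> T c -> cross a b c != 0 ->
    sqd a o = sqd b o -> sqd a o = sqd c o -> T o.

Lemma collinear_cross a b c : collinear a b c -> cross a b c = 0.
Proof.
move=> [L [[p [v [v0 ->]]] [t ->] [s ->] [r ->]]]; rewrite /cross /=; ring.
Qed.

(** The radius is positive: otherwise the three points would coincide. *)
Lemma center_set_center_closed S :
  contains_circle_centers S -> center_closed S.
Proof.
move=> hS a b c o Sa Sb Sc abc ab ac.
have nz : 0 < sqd a o.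
  rewrite lt_neqAle addr_ge0 ?sqr_ge0// andbT.
  apply: contraNneq abc => a0.
  have eqo x : 0 = sqd x o -> x = o.
    move=> /esym/eqP; rewrite /sqd paddr_eq0 ?sqr_ge0// !sqrf_eq0 !subr_eq0.
    by rewrite [RHS]surjective_pairing => /andP[/eqP<- /eqP<-]; case: (x).
  rewrite (eqo _ a0) (eqo b) -?ab// /cross; apply/eqP; ring.
apply: (hS a b c o) => //; first by move/collinear_cross/eqP; apply/negP.
exists (Num.sqrt (sqd a o)); rewrite sqrtr_gt0; split => //.
  by rewrite /circle /= /edist -/(sqd b o) ab.
by rewrite /circle /= /edist -/(sqd c o) ac.
Qed.

Lemma cross_eq0_line a b c : a != b -> cross a b c = 0 ->
  exists t, c = (a.1 + t * (b - a).1, a.2 + t * (b - a).2).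
Proof.
case: a b c => [a1 a2] [b1 b2] [c1 c2] /=; rewrite /cross /= => ab e.
case: (eqVneq a1 b1) => e1; last first.
  have h : b1 - a1 != 0 by rewrite subr_eq0 eq_sym.
  exists ((c1 - a1) / (b1 - a1)); congr pair; apply: (mulIf h).
    by field.
  have -> : (a2 + (c1 - a1) / (b1 - a1) * (b2 - a2)) * (b1 - a1) =
            a2 * (b1 - a1) + (b2 - a2) * (c1 - a1) by field.
  by move: e => /eqP; rewrite subr_eq0 => /eqP <-; ring.
have h : b2 - a2 != 0.
  by rewrite subr_eq0; apply: contraNneq ab => ->; rewrite e1.
move: e; rewrite e1 subrr mul0r sub0r => /eqP; rewrite oppr_eq0 mulf_eq0.
rewrite (negbTE h) /= subr_eq0 => /eqP ->.
by exists ((c2 - a2) / (b2 - a2)); congr pair; field.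
Qed.

(** A first point being chosen, a line through it misses some second point, and
the line through both misses a third one. *)
Lemma not_in_line_triangle S : (forall L, is_line L -> ~ S `<=` L) ->
  exists a b c, [/\ S a, S b, S c & cross a b c != 0].
Proof.
move=> hS.
have out p v : v != (0, 0) ->
    exists2 x, S x & ~ exists t, x = (p.1 + t * v.1, p.2 + t * v.2).
  move=> v0; apply: contrapT => h.
  apply: (hS [set x | exists t, x = (p.1 + t * v.1, p.2 + t * v.2)]).
    by exists p, v.
  by move=> x Sx; apply: contrapT => nx; apply: h; exists x.
have v0 : (1, 0) != (0, 0) :> R * R.
  by apply/eqP => -[] /eqP; rewrite oner_eq0.
have [a Sa _] := out (0, 0) (1, 0) v0.
have [b Sb nb] := out a (1, 0) v0.
have ab : a != b.
  apply/eqP => e; apply: nb; exists 0; rewrite -e !mul0r !addr0.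
  by case: (a).
have [|c Sc nc] := out a (b - a).
  by rewrite -[(0,0)]/(0 : R * R) subr_eq0 eq_sym.
exists a, b, c; split => //; apply/eqP => /(cross_eq0_line ab); exact: nc.
Qed.

(** The solution, by Cramer's rule, of the linear system that expresses that the
point lies on two perpendicular bisectors. *)
Definition circumcenter a b c : R * R :=
  (a.1 + ((c.2 - a.2) * sqd b a - (b.2 - a.2) * sqd c a) / (2 * cross a b c),
   a.2 + ((b.1 - a.1) * sqd c a - (c.1 - a.1) * sqd b a) / (2 * cross a b c)).

Lemma circumcenter_equidistant a b c : cross a b c != 0 ->
  sqd a (circumcenter a b c) = sqd b (circumcenter a b c) /\
  sqd a (circumcenter a b c) = sqd c (circumcenter a b c).
Proof.
case: a b c => [a1 a2] [b1 b2] [c1 c2].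
by rewrite /circumcenter /sqd /cross /= => h; split; field.
Qed.

(** Differences of squared distances are linear in [o]; the two given equations
are combined so as to eliminate one coordinate of [o]. *)
Lemma equidistant_circumcenter a b c o : cross a b c != 0 ->
  sqd a o = sqd b o -> sqd a o = sqd c o -> o = circumcenter a b c.
Proof.
case: a b c o => [a1 a2] [b1 b2] [c1 c2] [q1 q2].
rewrite /circumcenter /sqd /= => h /eqP; rewrite -subr_eq0 => /eqP e1.
move=> /eqP; rewrite -subr_eq0 => /eqP e2.
have h2 : 2 * cross (a1, a2) (b1, b2) (c1, c2) != 0.
  by rewrite mulf_neq0// pnatr_eq0.
rewrite -[LHS]/(q1, q2).
congr pair; apply: (mulIf h2); rewrite [RHS]mulrDl divfK//;
  apply/eqP; rewrite -subr_eq0; apply/eqP; rewrite /cross /= ?mulrDl.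
  transitivity ((c2 - a2) * ((a1 - q1) ^+ 2 + (a2 - q2) ^+ 2 -
      ((b1 - q1) ^+ 2 + (b2 - q2) ^+ 2)) -
    (b2 - a2) * ((a1 - q1) ^+ 2 + (a2 - q2) ^+ 2 -
      ((c1 - q1) ^+ 2 + (c2 - q2) ^+ 2))); first by ring.
  by rewrite e1 e2; ring.
transitivity (- (c1 - a1) * ((a1 - q1) ^+ 2 + (a2 - q2) ^+ 2 -
      ((b1 - q1) ^+ 2 + (b2 - q2) ^+ 2)) +
    (b1 - a1) * ((a1 - q1) ^+ 2 + (a2 - q2) ^+ 2 -
      ((c1 - q1) ^+ 2 + (c2 - q2) ^+ 2))); first by ring.
by rewrite e1 e2; ring.
Qed.

Lemma cvg_circumcenter a b c : cross a b c != 0 ->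
  cross t.1.1 t.1.2 t.2 @[t --> (a, b, c)] --> cross a b c /\
  circumcenter t.1.1 t.1.2 t.2 @[t --> (a, b, c)] --> circumcenter a b c.
Proof.
move=> h.
have pa : t.1.1 @[t --> (a, b, c)] --> a.
  by apply: (cvg_comp _ _ (@cvg_fst _ _ _ (nbhs c) _)); exact: cvg_fst.
have pb : t.1.2 @[t --> (a, b, c)] --> b.
  by apply: (cvg_comp _ _ (@cvg_fst _ _ _ (nbhs c) _)); exact: cvg_snd.
have pc : t.2 @[t --> (a, b, c)] --> c by exact: cvg_snd.
have f1 (f : R * R * (R * R) * (R * R) -> R * R) (d : R * R) :
    f t @[t --> (a, b, c)] --> d -> (f t).1 @[t --> (a, b, c)] --> d.1.
  by move=> fd; apply: (cvg_comp _ _ fd); exact: cvg_fst.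
have f2 (f : R * R * (R * R) * (R * R) -> R * R) (d : R * R) :
    f t @[t --> (a, b, c)] --> d -> (f t).2 @[t --> (a, b, c)] --> d.2.
  by move=> fd; apply: (cvg_comp _ _ fd); exact: cvg_snd.
have csq (f g : R * R * (R * R) * (R * R) -> R * R) (d e : R * R) :
    f t @[t --> (a, b, c)] --> d -> g t @[t --> (a, b, c)] --> e ->
    sqd (f t) (g t) @[t --> (a, b, c)] --> sqd d e.
  move=> fd ge; rewrite /sqd; under eq_fun do rewrite !expr2; rewrite !expr2.
  by apply: cvgD; apply: cvgM; apply: cvgB;
    do [exact: f1 | exact: f2].
have cx : cross t.1.1 t.1.2 t.2 @[t --> (a, b, c)] --> cross a b c.
  by apply: cvgB; apply: cvgM; apply: cvgB; do [exact: f1 | exact: f2].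
split => //.
have ci : (2 * cross t.1.1 t.1.2 t.2)^-1 @[t --> (a, b, c)] -->
          (2 * cross a b c)^-1.
  apply: cvgV; [rewrite mulf_neq0// pnatr_eq0 |].
  by apply: cvgM => //; exact: cvg_cst.
rewrite /circumcenter; apply: (@cvg_pair _ _ _ _ (nbhs _) (nbhs _));
  apply: cvgD; do ?[exact: f1 | exact: f2];
  (apply: cvgM => //; apply: cvgB; apply: cvgM; do ?exact: csq);
  apply: cvgB; do [exact: f1 | exact: f2].
Qed.

(** Triangles with vertices in [S] that are close to a nondegenerate triangle
are nondegenerate, and their circumcenters lie in [S] and converge. *)
Lemma closure_center_closed S : center_closed S -> center_closed (closure S).
Proof.
move=> hS a b c o clSa clSb clSc abc oab oac.
rewrite (equidistant_circumcenter abc oab oac).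
have [cx cc] := cvg_circumcenter abc.
move=> U /cc nU.
have {}nU : \forall t \near (a, b, c), U (circumcenter t.1.1 t.1.2 t.2) by [].
have : \forall t \near (a, b, c), cross t.1.1 t.1.2 t.2 != 0.
  apply: (cx [set x | x != 0]).
  by apply: open_nbhs_nbhs; split => //; exact: open_neq.
move=> /(filterI nU) [[AB C] /= [[[A B] /= [nA nB] AB'] nC] sub].
have [x [Sx Ax]] := clSa _ nA; have [y [Sy By]] := clSb _ nB.
have [z [Sz Cz]] := clSc _ nC.
have [|/= Uo xyz] := sub (x, y, z); first by split => //; exact: AB'.
exists (circumcenter x y z); split => //.
have [? ?] := circumcenter_equidistant xyz.
exact: (hS x y z).
Qed.

(** * Similarities *)

(** In complex notation, [frame p v z] is p + z v. *)
Definition frame p v z : R * R :=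
  (p.1 + z.1 * v.1 - z.2 * v.2, p.2 + z.1 * v.2 + z.2 * v.1).

Lemma normsq_neq0 v : v != 0 -> v.1 ^+ 2 + v.2 ^+ 2 != 0.
Proof.
case: v => v1 v2 /=; apply: contraNneq => /eqP.
by rewrite paddr_eq0 ?sqr_ge0// !sqrf_eq0 => /andP[/eqP-> /eqP->].
Qed.

(** The frame multiplies squared distances and areas by the same factor. *)
Lemma center_closed_frame p v T :
  center_closed T -> v != 0 -> center_closed (frame p v @^-1` T).
Proof.
move=> hT /normsq_neq0 v0 a b c o Ta Tb Tc abc ab ac.
have sq x y : sqd (frame p v x) (frame p v y) =
    (v.1 ^+ 2 + v.2 ^+ 2) * sqd x y by rewrite /sqd /frame /=; ring.
apply: (hT _ _ _ (frame p v o) Ta Tb Tc); rewrite ?sq ?ab ?ac//.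
  have -> : cross (frame p v a) (frame p v b) (frame p v c) =
    (v.1 ^+ 2 + v.2 ^+ 2) * cross a b c by rewrite /cross /frame /=; ring.
  by rewrite mulf_neq0.
by rewrite -ab ac.
Qed.

Lemma continuous_frame p v : continuous (frame p v).
Proof.
move=> z; apply: (@cvg_pair _ _ _ _ (nbhs _) (nbhs _));
  [apply: cvgB|apply: cvgD];
  do ?[apply: cvgD]; try exact: cvg_cst;
  apply: cvgM; do ?exact: cvg_cst; do [exact: cvg_fst|exact: cvg_snd].
Qed.

Lemma closed_frame p v T : closed T -> closed (frame p v @^-1` T).
Proof.
by move=> cT; apply: preimage_closed => // z _; exact: continuous_frame.
Qed.

(** This is what makes a change of coordinates harmless: the goal, that [T] is
everything, may be proved in any frame. *)
Lemma frame_full p v T : v != 0 ->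
  (forall z, T (frame p v z)) -> forall z, T z.
Proof.
move=> /normsq_neq0 v0 h z.
have -> : z = frame p v
  (((z.1 - p.1) * v.1 + (z.2 - p.2) * v.2) / (v.1 ^+ 2 + v.2 ^+ 2),
   ((z.2 - p.2) * v.1 - (z.1 - p.1) * v.2) / (v.1 ^+ 2 + v.2 ^+ 2));
  last exact: h.
by case: z => z1 z2; rewrite /frame /=; congr pair; field.
Qed.

(** All limits taken below run along straight lines. *)
Lemma closed_line T (z w : R * R) : closed T ->
  (forall e, 0 < e -> exists2 t, `|t| < e & T (z.1 + t * w.1, z.2 + t * w.2)) ->
  T z.
Proof.
move=> cT h; apply: cT => U nU.
have cont (x y : R) : continuous (fun t : R => x + t * y).
  move=> t; apply: cvgD; first exact: cvg_cst.
  by apply: cvgM; [exact: cvg_id|exact: cvg_cst].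
have : (fun t : R => (z.1 + t * w.1, z.2 + t * w.2)) @ (0 : R) --> z.
  have zE : z = (z.1 + 0 * w.1, z.2 + 0 * w.2).
    by rewrite !mul0r !addr0; case: (z).
  rewrite [X in _ --> X]zE.
  by apply: (@cvg_pair _ _ _ _ (nbhs _) (nbhs _)); exact: cont.
move=> /(_ _ nU) /nbhs_ballP [e /= e0 sub].
have [t te Tt] := h _ e0.
exists (z.1 + t * w.1, z.2 + t * w.2); split => //; apply: sub.
by rewrite /ball /= sub0r normrN.
Qed.

(** * Density from two nearby factors *)

Lemma expr_small (r e : R) : 0 < r < 1 -> 0 < e -> exists n, r ^+ n < e.
Proof.
move=> /andP[r0 r1] e0.
have r1' : `|r| < 1 by rewrite gtr0_norm.
have /cvgr0Pnorm_lt/(_ _ e0)[n _ /(_ n (leqnn n))] := cvg_expr r1'.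
by rewrite /= normrX gtr0_norm// => ?; exists n.
Qed.

Lemma geometric_bracket (g s t : R) : 1 < g -> 0 < s -> s <= t ->
  exists n, s * g ^+ n <= t < s * g ^+ n.+1.
Proof.
move=> g1 s0 st; have g0 : 0 < g by apply: lt_trans g1.
have exn : exists n, t < s * g ^+ n.
  have [||n hn] := @expr_small g^-1 (s / t).
  - by rewrite invr_gt0 g0 invf_lt1.
  - by rewrite divr_gt0// (lt_le_trans s0).
  exists n; move: hn; rewrite exprVn.
  rewrite ltr_pdivlMr ?(lt_le_trans s0)// mulrC ltr_pdivrMr ?exprn_gt0//.
case: (ex_minnP exn) => -[|n]; first by rewrite mulr1 ltNge st.
move=> h1 h2; exists n; rewrite h1 andbT leNgt; apply/negP => /h2.
by rewrite ltnn.
Qed.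

(** The products [c ^+ (K - l) * (c * (1 + h)) ^+ l], for l from 0 to K, form a
geometric progression of ratio [1 + h]. When K is large it stretches over a
factor of at least [g], so that its multiples by powers of [g] leave no gap of
ratio more than [1 + h] above [c ^+ K]. *)
Lemma multiplicative_density (X : R -> Prop) (c g : R) :
  0 < c < 1 -> 1 < g -> X 1 ->
  (forall x, 0 < x -> X x -> X (x * c)) ->
  (forall x, 0 < x -> X x -> X (x * g)) ->
  (forall d : R, 0 < d -> exists2 h, 0 < h < d &
     forall x, 0 < x -> X x -> X (x * (c * (1 + h)))) ->
  forall t e, 0 < t -> 0 < e -> exists2 x, X x & `|x - t| < e.
Proof.
move=> /andP[c0 c1] g1 X1 Xc Xg Xh t e t0 e0.
have g0 : 0 < g by apply: lt_trans g1.
have [|h /andP[h0 hd] Xch] := Xh (e / t); first by rewrite divr_gt0.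
have Xiter m : 0 < m -> (forall x, 0 < x -> X x -> X (x * m)) ->
    forall n x, 0 < x -> X x -> X (x * m ^+ n).
  move=> m0 Xm; elim=> [|n IH] x x0 Xx; first by rewrite mulr1.
  by rewrite exprS mulrA; apply: IH; [rewrite mulr_gt0|exact: Xm].
have h1 : 1 < 1 + h by rewrite ltrDl.
have [K1 hK1] : exists K, g < (1 + h) ^+ K.
  have [||K hK] := @expr_small (1 + h)^-1 g^-1.
  - by rewrite invr_gt0 invf_lt1; lra.
  - by rewrite invr_gt0.
  by exists K; move: hK; rewrite exprVn ltf_pV2// posrE exprn_gt0//; lra.
have [K2 hK2] : exists K, c ^+ K < t by apply: expr_small; rewrite ?c0.
(* K1 makes the progression long enough, K2 makes it start below t. *)
pose K := (K1 + K2)%N.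
have cK0 : 0 < c ^+ K by rewrite exprn_gt0.
have cKt : c ^+ K <= t.
  apply: le_trans (ltW hK2); rewrite /K exprD.
  apply: ler_piMl; first exact/exprn_ge0/ltW.
  by apply: exprn_ile1; exact: ltW.
have gK : g <= (1 + h) ^+ K.
  apply: le_trans (ltW hK1) _; rewrite ler_eXn2l// /K leq_addr//.
(* The power of g positions the progression so that it contains t. *)
have [j /andP[j1 j2]] := geometric_bracket g1 cK0 cKt.
have s0 : 0 < c ^+ K * g ^+ j by rewrite mulr_gt0// exprn_gt0.
have [l /andP[l1 l2]] := geometric_bracket h1 s0 j1.
have lK : (l <= K)%N.
  rewrite leqNgt; apply/negP => /ltnW Kl.
  have : t < t; last by rewrite ltxx.
  apply: lt_le_trans j2 _; apply: le_trans l1.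
  rewrite exprSr mulrA ler_pM2l//; apply: le_trans gK _.
  by rewrite ler_eXn2l.
exists (c ^+ K * g ^+ j * (1 + h) ^+ l).
  have -> : c ^+ K * g ^+ j * (1 + h) ^+ l =
      1 * g ^+ j * c ^+ (K - l) * (c * (1 + h)) ^+ l.
    by rewrite -{1}(subnK lK) exprD exprMn; ring.
  apply: (Xiter) => //; first by rewrite mulr_gt0//; lra.
    by rewrite !mulr_gt0// exprn_gt0.
  by apply: (Xiter) => //; [rewrite mulr_gt0// exprn_gt0 | apply: (Xiter)].
rewrite distrC ger0_norm ?subr_ge0//.
move: l2; rewrite exprSr mulrA mulrDr mulr1 -ltrBlDl => /lt_le_trans; apply.
move: hd; rewrite ltr_pdivlMr// => /ltW; apply: le_trans.
by rewrite mulrC ler_pM2l.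
Qed.

(** * From a spiral to the plane *)

Lemma eq_point T x y x' y' : T (x, y) -> x = x' -> y = y' -> T (x', y').
Proof. by move=> h <- <-. Qed.

Definition clusters_along T d : Prop :=
  forall e, 0 < e -> exists2 t, 0 < t < e & T (t * d.1, t * d.2).

(** The circumcenter of 0, [t * d] and [z] depends affinely on [t], so the limit
of these centers as [t] tends to 0 is a limit along a line. Below, [r] is the
slope of this dependence. *)
Lemma tangent_center T d z :
  closed T -> center_closed T -> T (0, 0) -> clusters_along T d -> T z ->
  d.1 * z.2 - d.2 * z.1 != 0 ->
  let q := (z.1 ^+ 2 + z.2 ^+ 2) / (2 * (d.1 * z.2 - d.2 * z.1)) in
  T (- (q * d.2), q * d.1).
Proof.
move=> cT hT T0 Td Tz dz q.
pose r := (d.1 ^+ 2 + d.2 ^+ 2) / (2 * (d.1 * z.2 - d.2 * z.1)).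
apply: (closed_line (w := (r * z.2, - (r * z.1)))) => // e.
move=> /Td [t /andP[t0 te] Tt].
exists t; first by rewrite gtr0_norm.
apply: (hT _ _ _ _ T0 Tt Tz); rewrite /cross /sqd /q /r /=.
- by rewrite !subr0 -!mulrA -mulrBr mulf_neq0 ?(gt_eqF t0).
- by field.
- by field.
Qed.

Section Axes.
Context (T : set (R * R)) (cT : closed T) (hT : center_closed T).
Context (T0 : T (0, 0)).
Context (accx : clusters_along T (1, 0)) (accy : clusters_along T (0, 1)).

Lemma axis1_center x y : x != 0 -> T (x, y) ->
  T ((x ^+ 2 + y ^+ 2) / (2 * x), 0).
Proof.
move=> x0 Txy; have /= := tangent_center cT hT T0 accy Txy.
rewrite mul0r sub0r mul1r oppr_eq0 mulr0 => /(_ x0) /eq_point; apply => //.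
by field.
Qed.

Lemma axis2_center x y : y != 0 -> T (x, y) ->
  T (0, (x ^+ 2 + y ^+ 2) / (2 * y)).
Proof.
move=> y0 Txy; have /= := tangent_center cT hT T0 accx Txy.
rewrite mul0r subr0 mul1r => /(_ y0) /eq_point; apply => //.
  by rewrite mulr0 oppr0.
by rewrite mulr1.
Qed.

Lemma axis1_half n x : x != 0 -> T (x, 0) -> T (x / 2 ^+ n, 0).
Proof.
elim: n x => [|n IH] x x0 Tx; first by rewrite divr1.
have h2 : x / 2 != 0 by rewrite mulf_neq0// invr_eq0 pnatr_eq0.
have Th : T (x / 2, 0).
  by apply: eq_point (axis1_center x0 Tx) _ _ => //; field.
by apply: eq_point (IH _ h2 Th) _ _ => //; rewrite exprS invfM mulrA.
Qed.

Lemma axis2_half n y : y != 0 -> T (0, y) -> T (0, y / 2 ^+ n).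
Proof.
elim: n y => [|n IH] y y0 Ty; first by rewrite divr1.
have h2 : y / 2 != 0 by rewrite mulf_neq0// invr_eq0 pnatr_eq0.
have Th : T (0, y / 2).
  by apply: eq_point (axis2_center y0 Ty) _ _ => //; field.
by apply: eq_point (IH _ h2 Th) _ _ => //; rewrite exprS invfM mulrA.
Qed.

(** The circumcenter of 0, (u, 0) and (0, w) is (u / 2, w / 2), and both u and w
may be halved indefinitely. *)
Lemma axes_clusters_along x y : x != 0 -> y != 0 -> T (x, 0) -> T (0, y) ->
  clusters_along T (x, y).
Proof.
move=> x0 y0 Tx Ty e e0.
have [|n hn] := @expr_small 2^-1 e _ e0; first by lra.
exists (2^-1 ^+ n / 2).
  rewrite divr_gt0 ?exprn_gt0 ?invr_gt0//= (le_lt_trans _ hn)//.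
  by rewrite ler_piMr ?exprn_ge0 ?invr_ge0//; lra.
have n2 : 2 ^+ n != 0 :> R by rewrite expf_neq0// pnatr_eq0.
apply: (hT T0 (axis1_half n x0 Tx) (axis2_half n y0 Ty));
  rewrite /cross /sqd /= ?exprVn.
- by rewrite !subr0 mul0r subr0 !mulf_neq0// invr_eq0.
- by field.
- by field.
Qed.

(** The center of the circle through (a, 0) tangent to [d] at 0. *)
Lemma axis1_direction (a : R) d : a != 0 -> T (a, 0) -> d.2 != 0 ->
  clusters_along T d -> T (a / 2, - (a * d.1 / (2 * d.2))).
Proof.
move=> a0 Ta d0 Td; have /= := tangent_center cT hT T0 Td Ta.
have dz : d.1 * 0 - d.2 * a != 0 by rewrite mulr0 sub0r oppr_eq0 mulf_neq0.
move=> /(_ dz)/eq_point; apply; field;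
  by apply/andP; split.
Qed.

(** The previous center is projected back to the axis by a circle tangent to the
second axis. *)
Lemma axis1_scale (a : R) d : a != 0 -> T (a, 0) -> d.2 != 0 ->
  clusters_along T d ->
  T (a * (4^-1 * (1 + (d.1 / d.2) ^+ 2)), 0).
Proof.
move=> a0 Ta d0 Td.
have h2 : a / 2 != 0 by rewrite mulf_neq0// invr_eq0 pnatr_eq0.
apply: eq_point (axis1_center h2 (axis1_direction a0 Ta d0 Td)) _ _ => //.
by field; rewrite d0.
Qed.

(** The direction (1, r / 2) has a slope below 1 / 2, hence gives a factor above
5 / 4; the directions (1 / 2 ^ n, r) give factors that decrease to 1 / 4. *)
Lemma axis1_dense r : 0 < r < 1 -> T (1, 0) -> T (0, r) ->
  forall x, 0 < x -> T (x, 0).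
Proof.
move=> /andP[r0 r1] T1 Tr x x0.
apply: (closed_line (w := (1, 0)) cT) => /= e e0.
have Xscale d : d.2 != 0 -> clusters_along T d -> forall a : R, 0 < a ->
    T (a, 0) -> T (a * (4^-1 * (1 + (d.1 / d.2) ^+ 2)), 0).
  by move=> d2 Td a a0 Ta; apply: axis1_scale => //; rewrite gt_eqF.
have r_neq0 : r != 0 by rewrite gt_eqF.
have Th n : T (1 / 2 ^+ n, 0) by apply: axis1_half; rewrite ?oner_eq0.
have hn n : 1 / 2 ^+ n != 0 :> R.
  by rewrite mulf_neq0 ?oner_eq0// invr_eq0 expf_neq0// pnatr_eq0.
have [|||||z Xz zx] := @multiplicative_density (fun a : R => T (a, 0)) 4^-1
   (4^-1 * (1 + (1 / (r / 2)) ^+ 2)) _ _ T1 _ _ _ x e x0 e0.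
- lra.
- have u2 : 2 < 1 / (r / 2).
    by rewrite ltr_pdivlMr ?divr_gt0// mulrC divfK ?pnatr_eq0.
  by nra.
- move=> a a0 Ta; apply: eq_point (axis1_half 2 _ Ta) _ _ => //.
    by rewrite gt_eqF.
  by field.
- apply: (Xscale (1, r / 2)); first by rewrite mulf_neq0// invr_eq0 pnatr_eq0.
  apply: axes_clusters_along; rewrite ?oner_eq0//.
    by rewrite mulf_neq0// invr_eq0 pnatr_eq0.
  by have := axis2_half 1 r_neq0 Tr.
- move=> d d0.
  have [||n rn] := @expr_small 4^-1 (d * r ^+ 2); first by lra.
    by rewrite mulr_gt0 ?exprn_gt0.
  have n0 : 0 < (2 ^+ n)^-1 :> R by rewrite invr_gt0 exprn_gt0.
  exists ((1 / 2 ^+ n / r) ^+ 2).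
    rewrite exprn_gt0 ?divr_gt0//= exprMn exprVn ltr_pdivrMr ?exprn_gt0//.
    apply: le_lt_trans rn; rewrite div1r exprVn -exprM mulnC exprM exprVn.
    by rewrite (_ : 2 ^+ 2 = 4)//; ring.
  apply: (Xscale (1 / 2 ^+ n, r)) => //.
  by apply: axes_clusters_along.
by exists (z - x) => //; apply: eq_point Xz _ _; ring.
Qed.

(** Every point of the plane is the center of arbitrarily large circles, and
these have three points in the quadrant; Pythagorean triples give rational
directions for them. *)
Lemma fourth_quadrant_full :
  (forall x y, 0 < x -> y < 0 -> T (x, y)) -> forall z, T z.
Proof.
move=> TQ [z1 z2].
pose r := 5 * (`|z1| + `|z2| + 1).
have [n1 n2] := (normr_ge0 z1, normr_ge0 z2).
have [l1 l2] := (ler_norm (- z1), ler_norm z2); rewrite normrN in l1.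
have Q1 : T (z1 + r * (3 / 5), z2 - r * (4 / 5)) by apply: TQ; rewrite /r; lra.
have Q2 : T (z1 + r * (4 / 5), z2 - r * (3 / 5)) by apply: TQ; rewrite /r; lra.
have Q3 : T (z1 + r * (5 / 13), z2 - r * (12 / 13)).
  by apply: TQ; rewrite /r; lra.
have r0 : r != 0 by rewrite gt_eqF// /r; lra.
apply: (hT Q1 Q2 Q3); rewrite /cross /sqd /=.
- have -> : (z1 + r * (4 / 5) - (z1 + r * (3 / 5))) * (z2 - r * (12 / 13) -
   (z2 - r * (4 / 5))) - (z2 - r * (3 / 5) - (z2 - r * (4 / 5))) *
   (z1 + r * (5 / 13) - (z1 + r * (3 / 5))) = r ^+ 2 * (6 / 325)
    by field.
  by rewrite mulf_neq0 ?expf_neq0//; lra.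
- by field.
- by field.
Qed.

(** To reach (x, y), take the point (2 x, 0) and the direction orthogonal to
(x, y). *)
Lemma axes_full r : 0 < r < 1 -> T (1, 0) -> T (0, r) -> forall z, T z.
Proof.
move=> r01 T1 Tr; have Tx := axis1_dense r01 T1 Tr.
have [r0 _] := andP r01; have r_neq0 : r != 0 by rewrite gt_eqF.
apply: fourth_quadrant_full => x y x0 y0.
have x20 : 0 < 2 * x by rewrite mulr_gt0.
have d0 : 0 < - (r * y / x).
  by rewrite oppr_gt0 pmulr_llt0 ?invr_gt0// nmulr_llt0.
have Td := axes_clusters_along (lt0r_neq0 d0) r_neq0 (Tx _ d0) Tr.
apply: eq_point (axis1_direction (lt0r_neq0 x20) (Tx _ x20) _ Td) _ _ => //=.
  by field.
by field; rewrite r_neq0 gt_eqF.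
Qed.

End Axes.

Lemma spiral_full T r : closed T -> center_closed T -> 0 < r < 1 ->
  (forall n, T (r ^+ (4 * n), 0)) -> (forall n, T (0, r ^+ (4 * n).+1)) ->
  forall z, T z.
Proof.
move=> cT hT r01 Tx Ty; have [r0 r1] := andP r01.
have small e k : 0 < e -> exists n, 0 < r ^+ (4 * n + k) < e.
  move=> e0; have [n hn] := expr_small r01 e0; exists n.
  rewrite exprn_gt0//=; apply: le_lt_trans hn.
  apply: ler_wiXn2l; rewrite ?ltW//; lia.
have accx : clusters_along T (1, 0).
  move=> e /(small _ 0)[n]; rewrite addn0 => hn; exists (r ^+ (4 * n)) => //=.
  by rewrite mulr1 mulr0.
have accy : clusters_along T (0, 1).
  move=> e /(small _ 1)[n]; rewrite addn1 => hn.
  exists (r ^+ (4 * n).+1) => //=.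
  by rewrite mulr1 mulr0.
have T0 : T (0, 0).
  apply: (closed_line (w := (1, 0)) cT) => e /accx[t /andP[t0 te] Tt].
  by exists t; [rewrite gtr0_norm | rewrite /= !add0r].
apply: (axes_full cT hT T0 accx accy r01); first exact: (Tx 0).
exact: (Ty 0).
Qed.

(** * From an isosceles triangle to a spiral *)

Definition isosceles T k : Prop := [/\ T (1, 0), T (-1, 0) & T (0, k)].

(** By the inscribed angle theorem, the circumcenter sees the base under twice
the apex angle; if k is the cotangent of half the angle, this is the duplication
formula of the cotangent. *)
Lemma isosceles_doubling T k : center_closed T -> k != 0 ->
  isosceles T k -> isosceles T ((k - k^-1) / 2).
Proof.
move=> hT k0 [T1 TN1 Tk]; split => //; apply: (hT _ _ _ _ T1 TN1 Tk);
  rewrite /cross /sqd /=; [|by field..].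
have -> : (-1 - 1) * (k - 0) - (0 - 0) * (0 - 1) = - 2 * k by ring.
by rewrite mulf_neq0// oppr_eq0 pnatr_eq0.
Qed.

(** The new base joins the circumcenter of the triangle to its apex. The new
apex is the circumcenter of this base and the vertex -1. It sees the new base
under twice the angle at -1, and this angle is half of the original one because
the old apex and -1 are equidistant from the circumcenter. *)
Lemma isosceles_rotation T k : center_closed T -> 0 < k -> isosceles T k ->
  isosceles
    (frame (0, (3 * k ^+ 2 - 1) / (4 * k)) (0, (k ^+ 2 + 1) / (4 * k)) @^-1` T)
    k.
Proof.
move=> hT kp Ik; have k0 := lt0r_neq0 kp; have [T1 TN1 Tk] := Ik.
have [_ _ Tk'] := isosceles_doubling hT k0 Ik.
split; rewrite /preimage /frame /=.
- by apply: eq_point Tk _ _; field.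
- by apply: eq_point Tk' _ _; field.
apply: (hT _ _ _ _ Tk' Tk TN1); rewrite /cross /sqd /=; [|by field..].
have -> : (0 - 0) * (0 - (k - k^-1) / 2) - (k - (k - k^-1) / 2) * (-1 - 0) =
   (k + k^-1) / 2 by field.
by rewrite gt_eqF// divr_gt0// addr_gt0 ?invr_gt0.
Qed.

(** In complex notation, the rotation of the previous lemma is
f (z) = i kap + i rho z, with fixed point - b for
b = kap (rho - i) / (1 + rho ^ 2). As - b is fixed, b + i kap = i rho b, so
replacing z by f (z) in - b + b w + z w amounts to replacing w by i rho w. The
apexes of the successive triangles are - b + (b + k i) w for w = (i rho) ^ n. *)
Lemma isosceles_contracting_full T k : closed T -> center_closed T ->
  0 < k -> k ^+ 2 + 1 < 4 * k -> isosceles T k -> forall z, T z.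
Proof.
move=> cT hT kp k4 Ik; have k0 := lt0r_neq0 kp.
pose rho := (k ^+ 2 + 1) / (4 * k); pose kap := (3 * k ^+ 2 - 1) / (4 * k).
have k21 : 0 < k ^+ 2 + 1 by rewrite addr_gt0 ?exprn_gt0.
have r01 : 0 < rho < 1.
  by rewrite divr_gt0 ?mulr_gt0//= ltr_pdivrMr ?mulr_gt0// mul1r.
have n0 : 1 + rho ^+ 2 != 0.
  by rewrite gt_eqF// addr_gt0// exprn_gt0//; case/andP: r01.
pose b : R * R := (kap * rho / (1 + rho ^+ 2), - kap / (1 + rho ^+ 2)).
(* The triangle of size and orientation w spiraling into - b. *)
pose P w := isosceles (frame (frame (- b) w b) w @^-1` T) k.
have Prot (x y x' y' : R) : x != 0 \/ y != 0 -> P (x, y) ->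
    - rho * y = x' -> rho * x = y' -> P (x', y').
  move=> xy0 Pw <- <-.
  have w0 : (x, y) != 0 :> R * R.
    by case: xy0 => nz; apply: contraNneq nz => -[/eqP x0 /eqP y0].
  have := isosceles_rotation (center_closed_frame hT w0) kp Pw.
  rewrite -/kap -/rho /P /isosceles /preimage /frame /= => -[T1 T2 T3].
  split; [apply: eq_point T1 _ _|apply: eq_point T2 _ _|apply: eq_point T3 _ _];
    by field.
have [rp _] := andP r01.
(* Four steps restore the orientation, since i ^ 4 = 1. *)
have P4 x : x != 0 -> P (x, 0) -> P (0, rho * x) /\ P (rho ^+ 4 * x, 0).
  move=> x0 Px.
  have rx n : rho ^+ n * x != 0 by rewrite mulf_neq0 ?expf_neq0 ?(gt_eqF rp).
  have P1 : P (0, rho * x) by apply: Prot Px _ _ => //; [left | ring].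
  have P2 : P (- rho ^+ 2 * x, 0).
    by apply: (Prot _ _ _ _ _ P1); [right; have := rx 1 | ring | ring].
  have P3 : P (0, - rho ^+ 3 * x).
    apply: (Prot _ _ _ _ _ P2); [left | ring | ring].
    by rewrite mulNr oppr_eq0.
  split=> //; apply: (Prot _ _ _ _ _ P3); [right | ring | ring].
  by rewrite mulNr oppr_eq0.
have rn n : rho ^+ n != 0 by rewrite expf_neq0 ?(gt_eqF rp).
have Pn n : P (rho ^+ (4 * n), 0).
  elim: n => [|n IH]; last by rewrite mulnS exprD; apply: (P4 _ _ IH).2.
  have [T1 T2 T3] := Ik.
  rewrite /P /isosceles /preimage /frame /= expr0.
  split; [apply: eq_point T1 _ _|apply: eq_point T2 _ _|apply: eq_point T3 _ _];
    by ring.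
pose v : R * R := (b.1, b.2 + k).
have Pv w : P w -> T (frame (- b) v w).
  by move=> [_ _]; rewrite /preimage /frame /= => /eq_point; apply; ring.
have v0 : v != 0.
  apply/eqP => -[/eqP b1 /eqP b2]; move: b1 b2.
  rewrite mulf_eq0 (mulf_eq0 kap) invr_eq0 (negbTE n0) (gt_eqF rp) !orbF.
  move=> /eqP kap0.
  by rewrite kap0 oppr0 mul0r add0r (negbTE k0).
apply: (frame_full v0); apply: (spiral_full _ _ r01).
- exact: closed_frame.
- exact: center_closed_frame.
- by move=> n; apply: Pv.
- by move=> n; apply: Pv; rewrite exprS; apply: (P4 _ _ (Pn n)).1.
Qed.

Lemma isosceles_flip T k : isosceles T k ->
  isosceles (frame 0 (-1, 0) @^-1` T) (- k).
Proof.
by move=> [T1 T2 T3]; rewrite /isosceles /preimage /frame /=;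
  split; [apply: eq_point T2 _ _|apply: eq_point T1 _ _|apply: eq_point T3 _ _];
  ring.
Qed.

Lemma flip_neq0 : (-1, 0) != 0 :> R * R.
Proof. by apply/eqP => -[/eqP]; rewrite oppr_eq0 oner_eq0. Qed.

(** When k is above 7 / 2, doubling the angle at least halves k but leaves it
above 1, and on the interval from 1 to 7 / 2 the contraction applies. *)
Lemma isosceles_tall_full T k : closed T -> center_closed T -> 1 <= k ->
  isosceles T k -> forall z, T z.
Proof.
move=> cT hT k1 Ik.
have [||n kn] := @expr_small 2^-1 (k^-1); [lra|rewrite invr_gt0; lra|].
have {kn} : k <= 7 / 2 * 2 ^+ n.
  move: kn; rewrite exprVn ltf_pV2 ?posrE ?exprn_gt0//; last by lra.
  by have : 0 < 2 ^+ n :> R; [rewrite exprn_gt0 | lra].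
elim: n k k1 Ik => [|n IH] k k1 Ik kn.
  by apply: (isosceles_contracting_full cT hT _ _ Ik); [lra|nra].
case: (lerP k (7 / 2)) => k7.
  by apply: (isosceles_contracting_full cT hT _ _ Ik); [lra|nra].
have kV : 0 < k^-1 < 1 by rewrite invr_gt0 invf_lt1; lra.
apply: (IH ((k - k^-1) / 2)); last by move: kn; rewrite exprS; lra.
  by lra.
by apply: isosceles_doubling => //; rewrite gt_eqF//; lra.
Qed.

(** An obtuse angle too close to 180 degrees becomes, once doubled and seen
from the other side, the small angle of a tall triangle. *)
Lemma isosceles_pos_full T k : closed T -> center_closed T -> 0 < k ->
  isosceles T k -> forall z, T z.
Proof.
move=> cT hT k0 Ik.
case: (lerP 1 k) => k1; first exact: isosceles_tall_full Ik.
case: (lerP (2 / 7) k) => k7.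
  by apply: (isosceles_contracting_full cT hT _ _ Ik) => //; nra.
apply: (frame_full flip_neq0).
apply: (isosceles_tall_full (closed_frame cT) (center_closed_frame hT flip_neq0)
  _ (isosceles_flip (isosceles_doubling hT (lt0r_neq0 k0) Ik))).
have : 7 / 2 < k^-1; last by lra.
by rewrite -[7 / 2]invrK ltf_pV2 ?posrE ?invr_gt0//; lra.
Qed.

Lemma isosceles_full T k : closed T -> center_closed T -> k != 0 ->
  isosceles T k -> forall z, T z.
Proof.
move=> cT hT; rewrite neq_lt => /orP[kn|kp] Ik;
  last exact: isosceles_pos_full Ik.
apply: (frame_full flip_neq0).
apply: (isosceles_pos_full (closed_frame cT) (center_closed_frame hT flip_neq0)
  _ (isosceles_flip Ik)).
by rewrite oppr_gt0.
Qed.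

(** The base and the circumcenter form an isosceles triangle, unless the angle
at (x, y) is right and the circumcenter is the midpoint 0 of the base. In that
case 0 is the apex of an isosceles triangle over the side from 1 to
(x, y). *)
Lemma segment_triangle_full T x y : closed T -> center_closed T -> y != 0 ->
  T (1, 0) -> T (-1, 0) -> T (x, y) -> forall z, T z.
Proof.
move=> cT hT y0 T1 TN1 Txy; pose k := (x ^+ 2 + y ^+ 2 - 1) / (2 * y).
have Tk : T (0, k).
  apply: (hT _ _ _ _ T1 TN1 Txy); rewrite /cross /sqd /k /=; [|by field..].
  have -> : (-1 - 1) * (y - 0) - (0 - 0) * (x - 1) = - 2 * y by ring.
  by rewrite mulf_neq0// oppr_eq0 pnatr_eq0.
have [k0|] := eqVneq k 0; last by move=> k0; apply: isosceles_full k0 _.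
have xy : y ^+ 2 = 1 - x ^+ 2.
  move: k0 => /eqP; rewrite mulf_eq0 invr_eq0 mulf_eq0 pnatr_eq0 (negbTE y0) /=.
  by rewrite orbF => /eqP ?; lra.
have x1 : 1 + x != 0.
  apply: contraNneq y0 => x1; rewrite -sqrf_eq0 xy; apply/eqP.
  have -> : 1 - x ^+ 2 = (1 + x) * (1 - x) by ring.
  by rewrite x1 mul0r.
have v0 : ((1 - x) / 2, - y / 2) != 0 :> R * R.
  by apply: contraNneq y0 => -[_ h]; apply/eqP; lra.
apply: (frame_full (p := ((1 + x) / 2, y / 2)) v0).
apply: (isosceles_full (closed_frame cT) (center_closed_frame hT v0)
  (k := - (1 + x) / y)).
  by rewrite mulf_neq0 ?oppr_eq0 ?invr_eq0.
split; rewrite /preimage /frame /=.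
- by apply: eq_point T1 _ _; field.
- by apply: eq_point Txy _ _; field.
rewrite k0 in Tk; apply: eq_point Tk _ _; first by field.
have -> : y / 2 + 0 * (- y / 2) + - (1 + x) / y * ((1 - x) / 2) =
   (y ^+ 2 - (1 - x ^+ 2)) / (2 * y) by field.
by rewrite xy subrr mul0r.
Qed.

Lemma triangle_full T a b c : closed T -> center_closed T ->
  T a -> T b -> T c -> cross a b c != 0 -> forall z, T z.
Proof.
case: a b c => [a1 a2] [b1 b2] [c1 c2] cT hT Ta Tb Tc.
rewrite /cross /= => abc.
pose v : R * R := ((b1 - a1) / 2, (b2 - a2) / 2).
have v0 : v != 0.
  apply: contraNneq abc => -[h1 h2].
  have -> : b1 - a1 = 0 by lra.
  have -> : b2 - a2 = 0 by lra.
  by rewrite !mul0r subr0.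
have n0 : (b1 - a1) ^+ 2 + (b2 - a2) ^+ 2 != 0.
  apply: contraNneq (normsq_neq0 v0) => ab0.
  by rewrite /= !expr_div_n -mulrDl ab0 mul0r.
pose p : R * R := ((a1 + b1) / 2, (a2 + b2) / 2).
apply: (frame_full (p := p) v0).
apply: (segment_triangle_full (closed_frame cT) (center_closed_frame hT v0)
  (x := ((c1 - p.1) * v.1 + (c2 - p.2) * v.2) / (v.1 ^+ 2 + v.2 ^+ 2))
  (y := ((c2 - p.2) * v.1 - (c1 - p.1) * v.2) / (v.1 ^+ 2 + v.2 ^+ 2))).
- rewrite mulf_neq0 ?invr_eq0 ?(normsq_neq0 v0)//.
  rewrite (_ : _ - _ = 2^-1 * ((b1 - a1) * (c2 - a2) - (b2 - a2) * (c1 - a1))).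
    by rewrite mulf_neq0// invr_eq0 pnatr_eq0.
  by rewrite /=; field.
- by apply: eq_point Tb _ _; rewrite /=; field.
- by apply: eq_point Ta _ _; rewrite /=; field.
- by apply: eq_point Tc _ _; rewrite /=; field.
Qed.

End CircleCenterSets.

Theorem theorem1 (R : realType) (S : set (R * R)) (hS : circle_center_set S) :
  dense S.
Proof.
have [nline cS] := hS.
have [a [b [c [Sa Sb Sc abc]]]] := not_in_line_triangle nline.
have clS := closure_center_closed (center_set_center_closed cS).
have full := triangle_full (@closed_closure _ S) clS (subset_closure Sa)
  (subset_closure Sb) (subset_closure Sc) abc.
move=> O [z Oz] oO.
have /(_ O) := full z.
by rewrite setIC; apply; apply: open_nbhs_nbhs.
Qed.
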